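(* Let $p_1,\dots,p_n\in(0,1]$, let $\mathbf{s}$ be the optimal threshold of the game $\mathcal{G}(p_1,\dots,p_n)$, and let $p:=\min\{p_i: i=\mathbf{s},\dots,n\}$. Then: (i) if $1\le R_1<\infty$, then $\mathcal{V}(p_1,\dots,p_n)\ge (1-p)^{-1+\frac1p}>\frac1e$; (ii) if $R_1<1$, then $\mathcal{V}(p_1,\dots,p_n)\ge R_1\left(\frac{n}{n+R_1}\right)^n$; (iii) if $R_1=\infty$, then $\mathcal{V}(p_1,\dots,p_n)\ge\max\left\{e^{-R_{\mathbf{s}+1}},\,(1-p)^{-1+\frac1p}\right\}$.
   Context: $\mathcal{G}(p_1,\dots,p_n)$ is the last-success game: independent Bernoulli variables $I_1,\dots,I_n$ ($n$ known) with $P(I_i=1)=p_i>0$ are observed sequentially, and the player wins if he stops on the last variable equal to $1$. Put $q_i=1-p_i$, $r_i=p_i/q_i$ (with $r_i=\infty$ if $p_i=1$), $R_k=\sum_{i=k}^n r_i\in[0,\infty]$ (empty sum $=0$). The optimal threshold is $\mathbf{s}=\max\{1\le k\le n: R_k\ge 1\}$ if $R_1\ge 1$, and $\mathbf{s}=1$ otherwise; it is optimal to stop on the first $1$ among $I_{\mathbf{s}},\dots,I_n$. The optimal win probability is $$\mathcal{V}(p_1,\dots,p_n)=\Big(\prod_{j=\mathbf{s}}^n q_j\Big)\Big(\sum_{i=\mathbf{s}}^n r_i\Big)\ \text{ if } p_{\mathbf{s}}<1,\qquad \mathcal{V}(p_1,\dots,p_n)=\prod_{j=\mathbf{s}+1}^n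 q_j\ \text{ if } p_{\mathbf{s}}=1$$ (empty product $=1$).
   Formalization: In (iii) the bound V ≥ e^{-R_{s+1}} is stated only when R_s = ∞ (i.e. p_s = 1); as printed it fails for n = 2, p_1 = 1, p_2 = 1/2, where s = 2, R_3 = 0 and V = 1/2 < 1. The bound (1-p)^{-1+1/p} is kept for all R_1 = ∞. *)

(* Defs.v *)
(* Indices are 0-based: the ordinal i : 'I_n stands for the index i+1 of
   p_1, ..., p_n, so that odds_sum p k below is r_{k+1} + ... + r_n and
   threshold p is s - 1. *)
From HB Require Import structures.
From mathcomp Require Import all_boot all_order all_algebra.
From mathcomp Require Import all_classical all_reals all_analysis.

Set Implicit Arguments.
Unset Strict Implicit.
Unset Printing Implicit Defensive.

Import Order.TTheory GRing.Theory Num.Theory.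

Local Open Scope ring_scope.

Section LastSuccess.
Context {R : realType} {n : nat}.
Implicit Types (p : 'I_n -> R) (w : {ffun 'I_n -> bool}).

Definition outcome_prob p w : R :=
  \prod_(i < n) (if w i then p i else 1 - p i).

(* tau w = Some k means stopping on the k-th variable, None means never
   stopping; the decision to stop at k may depend only on w 0, ..., w k. *)
Definition stopping_rule (tau : {ffun {ffun 'I_n -> bool} -> option 'I_n}) :
    bool :=
  [forall w : {ffun 'I_n -> bool}, forall w' : {ffun 'I_n -> bool},
   forall k : 'I_n,
     (tau w == Some k) && [forall i : 'I_n, (i <= k)%N ==> (w i == w' i)]
     ==> (tau w' == Some k)].

Definition last_success w (k : 'I_n) : bool :=
  w k && [forall j : 'I_n, (k < j)%N ==> ~~ w j].

Definition wins (tau : {ffun {ffun 'I_n -> bool} -> option 'I_n}) w : bool :=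
  if tau w is Some k then last_success w k else false.

Definition win_prob p (tau : {ffun {ffun 'I_n -> bool} -> option 'I_n}) : R :=
  \sum_(w | wins tau w) outcome_prob p w.

(* Win probabilities are nonnegative and stopping rules exist, so the default
   value 0 does not affect this maximum over a finite nonempty set. *)
Definition value p : R :=
  \big[Num.max/0]_(tau | stopping_rule tau) win_prob p tau.

Definition odds p (i : 'I_n) : \bar R :=
  if p i == 1 then +oo%E else (p i / (1 - p i))%:E.

Definition odds_sum p (k : nat) : \bar R :=
  (\sum_(i < n | (k <= i)%N) odds p i)%E.

Definition threshold p : nat :=
  if (1%:E <= odds_sum p 0)%E
  then (\max_(k < n | (1%:E <= odds_sum p k)%E) k)%N else 0%N.

(* When 0 < n and all p i <= 1, the range is nonempty and the default value 1
   does not affect this minimum. *)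
Definition pmin p : R :=
  \big[Num.min/1]_(i < n | (threshold p <= i)%N) p i.

End LastSuccess.

(* Main.v *)
(* Stopping on the first success from index s on is a stopping rule, so its win
   probability bounds the value from below. Let T be the sum of the odds after
   s, Q the product of the failure probabilities after s and
   c = ln (1 + r) / r, where r is the smallest odds from s on. Then the rule wins
   with probability (1 - (1 - p_s) (1 - T)) Q, and (1 - p)^(-1 + 1/p) = e^(-c).
   Since ln (1 + x) / x is nonincreasing, Q >= e^(-c T); since moreover
   1 - T <= r_s, the first factor is at least e^(-c (1 - T)). The remaining
   bounds are c < 1, AM-GM for the product of the 1 + r_i = 1 / q_i, and
   1 + r_i <= e^(r_i). *)
Require Import Defs.
From HB Require Import structures.
From mathcomp Require Import all_boot all_order all_algebra.
From mathcomp Require Import all_classical all_reals all_analysis.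
From mathcomp Require Import ring lra.

Set Implicit Arguments.
Unset Strict Implicit.
Unset Printing Implicit Defensive.

Import Order.TTheory GRing.Theory Num.Theory.

Local Open Scope ring_scope.

(** * Win probability of the threshold rules *)

Section ThresholdRule.
Context {R : realType} {n : nat}.
Implicit Types (p : 'I_n -> R) (w : {ffun 'I_n -> bool}).

Definition first_success_from (k : nat) w (i : 'I_n) : bool :=
  [&& (k <= i)%N, w i & [forall j : 'I_n, (k <= j < i)%N ==> ~~ w j]].

Definition threshold_rule (k : nat) :
    {ffun {ffun 'I_n -> bool} -> option 'I_n} :=
  [ffun w => [pick i | first_success_from k w i]].

Lemma first_success_from_inj k w i i' :
  first_success_from k w i -> first_success_from k w i' -> i = i'.
Proof.
move=> /and3P[ki wi /forallP fi] /and3P[ki' wi' /forallP fi'].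
apply: val_inj; case: (ltngtP i i') => //= [lt|lt].
  by move: (fi' i); rewrite ki lt wi.
by move: (fi i'); rewrite ki' lt wi'.
Qed.

(** [pick] returns an unspecified witness; uniqueness of the first success determines it. *)
Lemma threshold_ruleE k w i :
  (threshold_rule k w == Some i) = first_success_from k w i.
Proof.
rewrite ffunE; case: pickP => [j fj|/(_ i) ->//].
apply/eqP/idP => [[<-]//|fi].
by congr Some; apply: first_success_from_inj fj fi.
Qed.

Lemma threshold_rule_stopping k : stopping_rule (threshold_rule k).
Proof.
apply/forallP => w; apply/forallP => w'; apply/forallP => i.
rewrite !threshold_ruleE; apply/implyP => /andP[/and3P[ki wi /forallP fi]].
move=> /forallP eqw; rewrite /first_success_from ki /=.
have {}eqw (j : 'I_n) : (j <= i)%N -> w j = w' j.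
  by move=> ji; move: (eqw j); rewrite ji => /eqP.
rewrite -eqw // wi; apply/forallP => j; apply/implyP => /andP[kj ji].
by rewrite -eqw 1?ltnW//; move: (fi j); rewrite kj ji.
Qed.

(** The first success from [k] on is also the last one exactly when it is the only one, so the
    winning outcomes split according to the index of that single success. *)
Lemma win_prob_threshold_rule p k :
  win_prob p (threshold_rule k) =
  \sum_(i < n | (k <= i)%N)
     p i * \prod_(j < n | (k <= j)%N && (j != i)) (1 - p j).
Proof.
rewrite /win_prob (eq_bigl (fun w => [exists i : 'I_n,
   (threshold_rule k w == Some i) && last_success w i])); last first.
  move=> w; rewrite /wins; case E: (threshold_rule k w) => [i|].
    apply/idP/existsP => [li|[j /andP[/eqP[<-]]//]].
    by exists i; rewrite eqxx.
  by apply/esym/existsP => -[].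
have [n0|n0] := posnP n.
  have noI : 'I_n -> False by case=> m; rewrite n0.
  rewrite big_pred0; last by move=> w; apply/existsP => -[i _]; case: (noI i).
  by rewrite big_pred0// => i; case: (noI i).
(* A mere default for [odflt]: on a winning outcome the rule does stop. *)
pose i0 := Ordinal n0.
rewrite (partition_big (fun w => odflt i0 (threshold_rule k w))
  (fun i : 'I_n => (k <= i)%N)); last first.
  move=> w /existsP[i /andP[+ _]]; move=> Ei.
  by rewrite (eqP Ei) /=; move: Ei; rewrite threshold_ruleE => /and3P[].
apply: eq_bigr => i ki.
(* Winning at [i] constrains each coordinate separately and leaves those before [k] free, so the sum
   over such outcomes factors by distributivity. *)
pose Q (j : 'I_n) (b : bool) := (k <= j)%N ==> (b == (j == i)).
transitivity (\sum_(w in family Q) outcome_prob p w).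
  apply: eq_bigl => w; apply/andP/familyP => [[/existsP[j /andP[Ej lj]] Ei] l|wQ].
    move: Ei; rewrite (eqP Ej) /= => /eqP ji; rewrite {j}ji in Ej lj.
    move: Ej lj; rewrite threshold_ruleE => /and3P[_ wi /forallP fi].
    move=> /andP[_ /forallP la]; rewrite unfold_in /Q.
    apply/implyP => kl; case: (ltngtP l i) => il.
    - by move: (fi l); rewrite kl il /= => /negbTE ->; rewrite -val_eqE /= ltn_eqF.
    - by move: (la l); rewrite il /= => /negbTE ->; rewrite -val_eqE /= gtn_eqF.
    - by have -> : l = i by [apply: val_inj]; rewrite wi eqxx.
  have {}wQ (l : 'I_n) : (k <= l)%N -> w l = (l == i).
    by move=> kl; move: (wQ l); rewrite unfold_in /Q kl => /eqP.
  have Ei : threshold_rule k w == Some i.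
    rewrite threshold_ruleE /first_success_from ki wQ// eqxx /=.
    apply/forallP => j; apply/implyP => /andP[kj ji].
    by rewrite wQ// -val_eqE /= ltn_eqF.
  split; last by rewrite (eqP Ei).
  apply/existsP; exists i; rewrite Ei /last_success wQ// eqxx /=.
  apply/forallP => j; apply/implyP => ij.
  by rewrite wQ -?val_eqE /= ?gtn_eqF// (leq_trans ki)// ltnW.
rewrite -(bigA_distr_big_dep Q (fun i (b : bool) => if b then p i else 1 - p i)).
(* A free coordinate contributes [p j + (1 - p j) = 1]. *)
rewrite (bigID (fun j : 'I_n => (k <= j)%N)) /= [X in _ * X]big1 ?mulr1; last first.
  move=> j /negbTE kj; rewrite (eq_bigl predT) => [|b]; last by rewrite /Q kj.
  by rewrite big_bool /=; ring.
rewrite (bigD1 i)//=; congr (_ * _).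
  by rewrite (eq_bigl (pred1 true)) ?big_pred1_eq// => b; rewrite /Q ki eqxx.
apply: eq_bigr => j /andP[kj /negbTE ji].
by rewrite (eq_bigl (pred1 false)) ?big_pred1_eq// => b; rewrite /Q kj ji.
Qed.

Lemma win_prob_le_value p k : win_prob p (threshold_rule k) <= value p.
Proof. exact: (le_bigmax_cond _ _ (threshold_rule_stopping k)). Qed.

(** Condition on variable [i]: after a success the rule wins if all later variables fail, and after
    a failure it continues as the rule from [i.+1]. Unlike the formula with odds, this covers
    [p i = 1]. *)
Lemma win_prob_threshold_ruleS p (i : 'I_n) :
  win_prob p (threshold_rule i) =
  p i * \prod_(j < n | (i < j)%N) (1 - p j) +
  (1 - p i) * win_prob p (threshold_rule i.+1).
Proof.
have ltE (j : 'I_n) : (i <= j)%N && (j != i) = (i < j)%N.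
  by rewrite ltn_neqAle andbC eq_sym -val_eqE.
rewrite !win_prob_threshold_rule (bigD1 i)//=; congr (_ * _ + _).
  exact: eq_bigl.
rewrite (eq_bigl _ _ ltE) mulr_sumr; apply: eq_bigr => j ij.
rewrite (bigD1 i) /=; last by rewrite leqnn -val_eqE ltn_eqF.
rewrite mulrCA; congr (_ * (_ * _)); apply: eq_bigl => l.
by rewrite -ltE andbAC.
Qed.

Lemma win_prob_threshold_ruleE p k :
  (forall i : 'I_n, (k <= i)%N -> p i < 1) ->
  win_prob p (threshold_rule k) =
  (\sum_(i < n | (k <= i)%N) p i / (1 - p i)) *
  \prod_(j < n | (k <= j)%N) (1 - p j).
Proof.
move=> p1; rewrite win_prob_threshold_rule mulr_suml; apply: eq_bigr => i ki.
by rewrite [in RHS](bigD1 i)//= mulrA divfK// subr_eq0 gt_eqF// p1.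
Qed.

(** * Sums of odds and the threshold index *)

Lemma odds_sum_fin p k : (forall i, 0 < p i <= 1) ->
  (odds_sum p k < +oo)%E -> forall i : 'I_n, (k <= i)%N -> p i < 1.
Proof.
move=> hp; rewrite ltey => Rk i ki.
have /andP[_] := hp i; rewrite le_eqVlt => /predU1P[pi1|//].
move/eqP: Rk; case; apply/esum_eqyP => [j _|].
  by rewrite /odds; case: ifP.
by exists i; rewrite /odds pi1 eqxx mem_index_enum.
Qed.

Lemma odds_sumE p k : (forall i : 'I_n, (k <= i)%N -> p i < 1) ->
  odds_sum p k = (\sum_(i < n | (k <= i)%N) p i / (1 - p i))%:E.
Proof.
move=> p1; rewrite -sumEFin; apply: eq_bigr => i ki.
by rewrite /odds lt_eqF// p1.
Qed.

Lemma odds_sumS p (i : 'I_n) :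
  odds_sum p i = (odds p i + odds_sum p i.+1)%E.
Proof.
rewrite /odds_sum (bigD1 i)//=; congr (_ + _)%E; apply: eq_bigl => j.
by rewrite ltn_neqAle andbC eq_sym -val_eqE.
Qed.

Lemma threshold_odds_sum p : (0 < n)%N -> (1%:E <= odds_sum p 0)%E ->
  [/\ (threshold p < n)%N, (1%:E <= odds_sum p (threshold p))%E
    & (odds_sum p (threshold p).+1 < 1%:E)%E].
Proof.
move=> n0 R0; rewrite /threshold R0.
pose P := fun k : 'I_n => (1%:E <= odds_sum p k)%E.
have P0 : (0 < #|P|)%N by apply/card_gt0P; exists (Ordinal n0).
have [s Ps sE] := eq_bigmax_cond (fun k : 'I_n => k : nat) P0.
have maxE : (\max_(k < n | (1%:E <= odds_sum p k)%E) k)%N = s by exact: sE.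
rewrite maxE.
split; [exact: ltn_ord|exact: Ps|].
rewrite ltNge; apply/negP => Rs1.
(* Either [s.+1] is an index and contradicts the maximality of [s], or the sum after [s] is empty,
   hence 0. *)
have [sn|] := ltnP s.+1 n.
  have := @leq_bigmax_cond _ P (fun k : 'I_n => k : nat) (Ordinal sn) Rs1.
  by rewrite [X in (_ <= X)%N]maxE ltnn.
move=> ns; move: Rs1; rewrite /odds_sum big_pred0 ?lee_fin ?ler10// => j.
by rewrite leqNgt (leq_trans (ltn_ord j)).
Qed.
End ThresholdRule.

(** * Logarithmic and exponential estimates *)

Section LogSlope.
Context {R : realType}.
Implicit Types (x y a b d r : R).

(** Concavity of [ln] on the segment from 1 to [1 + y], at weight [x / y]. The product form of the
    monotonicity of ln (1 + x) / x allows [x = 0]. *)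
Lemma mul_ln1D_le x y : 0 <= x <= y -> x * ln (1 + y) <= y * ln (1 + x).
Proof.
move=> /andP[x0 xy]; have [y0|y0] := leP y 0.
  by have -> : x = y by lra.
have xy0 : 0 <= x / y by rewrite divr_ge0// ltW.
have xy1 : x / y <= 1 by rewrite ler_pdivrMr// mul1r.
have y1 : 0 < 1 + y by lra.
have := concave_ln (Itv01 xy0 xy1) y1 ltr01.
rewrite !convRE /= ln1 mulr0 addr0.
have -> : x / y * (1 + y) + unstable.onem (x / y) * 1 = 1 + x.
  by rewrite /unstable.onem; field; rewrite gt_eqF.
by move=> h; rewrite -ler_pdivrMl// mulrA [_ * x]mulrC.
Qed.

Definition log_slope r := ln (1 + r) / r.

Lemma ln1D_le_log_slope r x : 0 < r -> r <= x -> ln (1 + x) <= log_slope r * x.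
Proof.
move=> r0 rx; rewrite /log_slope mulrAC ler_pdivlMr// mulrC [leRHS]mulrC.
by apply: mul_ln1D_le; rewrite ltW.
Qed.

Lemma log_slope_lt1 r : 0 < r -> log_slope r < 1.
Proof.
move=> r0; have r1 : 0 < 1 + r by lra.
rewrite ltr_pdivrMr// mul1r -[ltRHS]expRK ltr_ln ?posrE ?expR_gt0//.
by rewrite expR_gt1Dx// gt_eqF.
Qed.

(** With r = a / (1 - a), one has 1 + r = 1 / (1 - a) and 1 / r = -1 + 1 / a. *)
Lemma powR_log_slope a : 0 < a < 1 ->
  (1 - a) `^ (-1 + 1 / a) = expR (- log_slope (a / (1 - a))).
Proof.
move=> /andP[a0 a1]; have q0 : 0 < 1 - a by lra.
rewrite /powR gt_eqF// /log_slope; congr expR.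
have -> : 1 + a / (1 - a) = (1 - a)^-1 by field; lra.
rewrite lnV ?posrE//; field; lra.
Qed.

Lemma odds_ge0 a : 0 < a <= 1 -> 0 <= a / (1 - a).
Proof. by move=> ?; rewrite divr_ge0; lra. Qed.

Lemma ler_odds a b : b < 1 -> a <= b -> a / (1 - a) <= b / (1 - b).
Proof.
move=> b1 ab; rewrite ler_pdivrMr; last lra.
by rewrite mulrAC ler_pdivlMr; lra.
Qed.

Lemma prod_failure_ge (I : finType) (P : pred I) a (p : I -> R) :
  0 < a -> (forall i, P i -> a <= p i < 1) ->
  expR (- (log_slope (a / (1 - a)) * \sum_(i | P i) p i / (1 - p i)))
    <= \prod_(i | P i) (1 - p i).
Proof.
move=> a0 ap; rewrite mulr_sumr -sumrN expR_sum.
apply: ler_prod => i Pi; have /andP[api p1] := ap i Pi.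
have q0 : 0 < 1 - p i by lra.
have a1 : 0 < a / (1 - a) by rewrite divr_gt0; lra.
rewrite expR_ge0/= -[leRHS]lnK ?posrE// ler_expR lerNl.
have := ln1D_le_log_slope a1 (ler_odds p1 api).
have -> : 1 + p i / (1 - p i) = (1 - p i)^-1 by field; lra.
by rewrite lnV ?posrE.
Qed.

(** Used with [a] the minimum, [b] the success probability at the threshold and [d] = 1 - T. The
    bound on [d] is conditional because [b = 1] has infinite odds. *)
Lemma expR_log_slope_le a b d : 0 < a -> a < 1 -> a <= b -> b <= 1 ->
  0 <= d -> (b < 1 -> d <= b / (1 - b)) ->
  expR (- (log_slope (a / (1 - a)) * d)) <= 1 - (1 - b) * d.
Proof.
move=> a0 a1 ab b1 d0 db; set r := a / (1 - a).
have r0 : 0 < r by rewrite divr_gt0; lra.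
(* The right-hand side increases with b, and b is at least a and d / (1 + d),
   the probability of odds d; the larger of the two is the worst case. *)
have [rd|dr] := leP r d.
  apply: (@le_trans _ _ ((1 + d)^-1)).
    have d1 : 0 < 1 + d by lra.
    rewrite expRN lef_pV2 ?posrE ?expR_gt0// -[leLHS]lnK ?posrE// ler_expR.
    exact: ln1D_le_log_slope.
  have [|b1'] := ltP b 1; last by rewrite -[leLHS]div1r ler_pdivrMr; nra.
  move=> b1'; move: (db b1'); rewrite ler_pdivlMr; last lra.
  move=> h; rewrite -[leLHS]div1r ler_pdivrMr; nra.
apply: (@le_trans _ _ (1 - (1 - a) * d)); last nra.
have q0 : 0 < 1 - (1 - a) * d.
  by move: dr; rewrite /r ltr_pdivlMr; lra.
rewrite -[leRHS]lnK ?posrE// ler_expR.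
(* Since 1 + r - d = (1 + r) (1 - (1 - a) d), comparing the slopes at [r - d] and [r] bounds the
   logarithm of the last factor below by -d ln (1 + r) / r. *)
have := @mul_ln1D_le (r - d) r.
rewrite subr_ge0 ltW//= lerBlDr lerDl => /(_ d0).
have q1 : 0 < (1 - a)^-1 by rewrite invr_gt0; lra.
have -> : 1 + (r - d) = (1 - a)^-1 * (1 - (1 - a) * d).
  by rewrite /r; field; lra.
have rE : (1 - a)^-1 = 1 + r by rewrite /r; field; lra.
rewrite lnM ?posrE// rE /log_slope => h.
rewrite lerNl -[leRHS]mulrA [_^-1 * d]mulrC mulrA ler_pdivlMr//; lra.
Qed.

Lemma prod_failure_ge_expR (I : finType) (P : pred I) (p : I -> R) :
  (forall i, P i -> p i < 1) ->
  expR (- \sum_(i | P i) p i / (1 - p i)) <= \prod_(i | P i) (1 - p i).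
Proof.
move=> p1; rewrite -sumrN expR_sum; apply: ler_prod => i /p1 pi1.
have q0 : 0 < 1 - p i by lra.
rewrite expR_ge0 expRN -[leRHS]invrK lef_pV2 ?posrE ?invr_gt0 ?expR_gt0//=.
rewrite [leLHS](_ : _ = 1 + p i / (1 - p i)); last by field; lra.
exact: expR_ge1Dx.
Qed.

End LogSlope.

(** * Lower bounds on the value *)

Section ValueBounds.
Context {R : realType} (n : nat) (p : 'I_n -> R) (n0 : (0 < n)%N)
  (hp : forall i, 0 < p i <= 1).

Lemma pmin_gt0 : 0 < pmin p.
Proof. by apply/bigmin_gtP; split => // i _; case/andP: (hp i). Qed.

Lemma pmin_le (i : 'I_n) : (threshold p <= i)%N -> pmin p <= p i.
Proof. exact: bigmin_le_cond. Qed.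

(** The odds after the threshold sum to less than 1, so from there on only the threshold index can
    have success probability 1. Splitting off that index treats finite and infinite R_1 together. *)
Lemma value_ge_pmin : (1%:E <= odds_sum p 0)%E ->
  (1 - pmin p) `^ (-1 + 1 / pmin p) <= value p.
Proof.
move=> R0; have [sn Rs Rs1] := threshold_odds_sum n0 R0.
pose s := Ordinal sn; set a := pmin p.
have as_ : a <= p s by exact: pmin_le.
have ps1 : p s <= 1 by case/andP: (hp s).
have p1 : forall j : 'I_n, (s < j)%N -> p j < 1.
  by apply: odds_sum_fin => //; rewrite (lt_trans Rs1) ?ltry.
apply: le_trans (win_prob_le_value p s).
rewrite win_prob_threshold_ruleS (win_prob_threshold_ruleE p1).
move: Rs Rs1; rewrite -[threshold p]/(s : nat) odds_sumS (odds_sumE p1).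
set T := \sum_(j < n | _) _; set Q := \prod_(j < n | _) _.
rewrite lte_fin => Rs T1.
have {R0}Rs : p s < 1 -> 1 - T <= p s / (1 - p s).
  by move: Rs; rewrite /odds => + ps; rewrite lt_eqF// lee_fin lerBlDr.
have T0 : 0 <= T.
  by apply: sumr_ge0 => j _; apply: odds_ge0.
(* If the minimum is 1, no index follows [s], as later probabilities are below 1; the bound then
   reads 0^0, which [powR] evaluates to 1. *)
have [a1|a1] := ltP a 1; last first.
  have a1E : a = 1 by lra.
  have tail0 (j : 'I_n) : (s < j)%N = false.
    apply/negP => sj; have := p1 j sj; have := pmin_le (ltnW sj).
    by rewrite -/a; lra.
  rewrite /T /Q !big_pred0// mul0r mulr0 addr0 mulr1 a1E divr1 addNr powRr0.
  by rewrite -a1E.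
rewrite powR_log_slope ?pmin_gt0//.
set c := log_slope _.
have -> : - c = - (c * (1 - T)) + - (c * T) by ring.
rewrite expRD.
have -> : p s * Q + (1 - p s) * (T * Q) = (1 - (1 - p s) * (1 - T)) * Q by ring.
apply: ler_pM; rewrite ?expR_ge0//.
  apply: expR_log_slope_le => //; [exact: pmin_gt0|lra].
apply: prod_failure_ge => [|j sj]; first exact: pmin_gt0.
by rewrite p1// andbT pmin_le// ltnW.
Qed.

Lemma value_ge_expR : (1%:E <= odds_sum p 0)%E ->
  odds_sum p (threshold p) = +oo%E ->
  expR (- fine (odds_sum p (threshold p).+1)) <= value p.
Proof.
move=> R0; have [sn Rs Rs1] := threshold_odds_sum n0 R0.
pose s := Ordinal sn.
have p1 : forall j : 'I_n, (s < j)%N -> p j < 1.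
  by apply: odds_sum_fin => //; rewrite (lt_trans Rs1) ?ltry.
rewrite -[threshold p]/(s : nat) odds_sumS (odds_sumE p1) => oo.
(* The odds after [s] have a finite sum, so the infinite term is the one at [s]. *)
have ps1 : p s = 1.
  by move: oo; rewrite /odds; case: eqP.
apply: le_trans (win_prob_le_value p s).
rewrite win_prob_threshold_ruleS ps1 subrr mul0r addr0 mul1r.
exact: prod_failure_ge_expR.
Qed.

(** The rule from index 0 wins with probability R_1 times the product of the q_i, and the n numbers
    1 + r_i = 1 / q_i have mean (n + R_1) / n. *)
Lemma value_ge_AGM : (odds_sum p 0 < 1%:E)%E ->
  fine (odds_sum p 0) * (n%:R / (n%:R + fine (odds_sum p 0))) ^+ n <= value p.
Proof.
move=> R1; have p1 : forall i : 'I_n, (0 <= i)%N -> p i < 1.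
  by apply: odds_sum_fin => //; rewrite (lt_trans R1) ?ltry.
apply: le_trans (win_prob_le_value p 0) => {R1}.
rewrite (win_prob_threshold_ruleE p1) (odds_sumE p1) /=.
set T := \sum_(i < n) _.
have o0 i : 0 <= p i / (1 - p i) by exact: odds_ge0.
have T0 : 0 <= T by apply: sumr_ge0 => i _.
rewrite ler_wpM2l//.
have nR0 : 0 < n%:R :> R by rewrite ltr0n.
have -> : \prod_(i < n) (1 - p i) = (\prod_(i < n) (1 + p i / (1 - p i)))^-1.
  rewrite -prodfV; apply: eq_bigr => i _.
  by have := p1 i isT => pi1; field; lra.
rewrite -[n%:R / _]invf_div exprVn lef_pV2 ?posrE; last 2 first.
- by rewrite exprn_gt0// divr_gt0// ltr_wpDr.
- by apply: prodr_gt0 => i _; rewrite ltr_wpDr.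
have := @leif_AGM _ _ (mem 'I_n) (fun i => 1 + p i / (1 - p i)).
case=> [i _|]; first by rewrite addr_ge0.
by rewrite big_split /= sumr_const card_ord.
Qed.
End ValueBounds.

Theorem theorem12 (R : realType) (n : nat) (hn : (0 < n)%N) (p : 'I_n -> R)
    (hp : forall i : 'I_n, 0 < p i <= 1) :
  [/\ ((1%:E <= odds_sum p 0)%E -> (odds_sum p 0 < +oo)%E ->
        (1 - pmin p) `^ (-1 + 1 / pmin p) <= value p /\
        1 / expR 1 < (1 - pmin p) `^ (-1 + 1 / pmin p)),
      ((odds_sum p 0 < 1%:E)%E ->
        fine (odds_sum p 0) * (n%:R / (n%:R + fine (odds_sum p 0))) ^+ n
          <= value p)
    & (odds_sum p 0 = +oo%E ->
        (1 - pmin p) `^ (-1 + 1 / pmin p) <= value p /\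
        (odds_sum p (threshold p) = +oo%E ->
          Num.max (expR (- fine (odds_sum p (threshold p).+1)))
                  ((1 - pmin p) `^ (-1 + 1 / pmin p)) <= value p))].
Proof.
split=> [R1 Rfin|R1|Roo]; last 1 first.
- have R1 : (1%:E <= odds_sum p 0)%E by rewrite Roo leey.
  (* [Rs] places a certain success at the threshold; [Roo] alone would allow it to occur only
     earlier. *)
  split=> [|Rs]; first exact: value_ge_pmin.
  by rewrite ge_max value_ge_expR// value_ge_pmin.
- split; first exact: value_ge_pmin.
  have [sn _ _] := threshold_odds_sum hn R1.
  have a0 := pmin_gt0 hp.
  (* A finite R_1 excludes certain successes, in particular at the threshold index, which bounds the
     minimum. *)
  have a1 : pmin p < 1.
    apply: le_lt_trans (pmin_le (i := Ordinal sn) (leqnn _)) _.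
    exact: (odds_sum_fin hp Rfin).
  rewrite powR_log_slope ?a0// div1r -expRN ltr_expR ltrN2.
  by apply: log_slope_lt1; rewrite divr_gt0// subr_gt0.
- exact: value_ge_AGM.
Qed.
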